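(* Let $r$ be a positive integer. Then for all integers $m\ge 0$, the elements $$(F_r\circ F_r)^m(x)\qquad\text{and}\qquad (F_r\circ F_r)^m(y)$$ of $K$ are non-commutative Laurent polynomials in $x$ and $y$ with non-negative integer coefficients.
   Context: $K=k(x,y)$ is the skew field of rational functions in the non-commutative variables $x$ and $y$ (the free skew field on $x,y$) over a ground field $k$, where $k$ is $\mathbb{Q}$ or any field containing $\mathbb{Q}$. For a positive integer $r$, $F_r$ is the Kontsevich automorphism of $K$, defined by $F_r(\lambda)=\lambda$ for all $\lambda\in k$, $F_r(x)=xyx^{-1}$ and $F_r(y)=(1+y^r)x^{-1}$. A non-commutative Laurent polynomial in $x$ and $y$ with non-negative integer coefficients is an element of $K$ that is a finite sum, with non-negative integer coefficients, of monomials $x^{a_1}y^{b_1}x^{a_2}y^{b_2}\cdots x^{a_m}y^{b_m}$ with $a_i,b_i\in\mathbb{Z}$. *)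

(* Defs.v *)
From HB Require Import structures.
From mathcomp Require Import all_boot all_order all_algebra.

Set Implicit Arguments.
Unset Strict Implicit.
Unset Printing Implicit Defensive.

Import GRing.Theory.
Local Open Scope ring_scope.

(** A skew field with k in its centre is a [unitAlgType k] that satisfies
    [GRing.field_axiom]: every nonzero element is a unit.  The product is not
    assumed to be commutative. *)

Section FreeSkewField.

Variables (k : fieldType).

(** P. M. Cohn's specializations, for the free algebra k<X, Y> acting on K
    through (x, y) and on L through (a, b).  The domain S is a k-subalgebra
    that contains x and y, and an element of S outside the kernel of phi has
    its inverse in S, so S is a local ring.  Only the values of phi on S
    matter. *)
Definition specialization (K L : unitAlgType k) (x y : K) (a b : L)
    (S : {pred K}) (phi : K -> L) : Prop :=
  [/\ [/\ GRing.subalg_closed S, x \in S & y \in S],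
      [/\ forall c : k, phi c%:A = c%:A,
          {in S &, {morph phi : u v / u + v}} &
          {in S &, {morph phi : u v / u * v}}],
      phi x = a /\ phi y = b &
      {in S, forall u, phi u != 0 -> u^-1 \in S}].

(** K is the free skew field k(x, y), i.e. the universal field of fractions of
    k<x, y>: K is a skew field, generated as such by k, x and y, and it
    specializes to every skew field over k with two chosen elements.
    Freeness of x and y is a consequence, since k<X, Y> embeds in some skew
    field over k. *)
Definition free_skew_field (K : unitAlgType k) (x y : K) : Prop :=
  [/\ GRing.field_axiom K,
      forall S : {pred K}, GRing.divalg_closed S -> x \in S -> y \in S ->
        forall u, u \in S &
      forall (L : unitAlgType k) (a b : L), GRing.field_axiom L ->
        exists (S : {pred K}) (phi : K -> L), specialization x y a b S phi].

Definition Kontsevich_automorphism (K : unitAlgType k) (x y : K) (r : nat)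
    (F : {rmorphism K -> K}) : Prop :=
  [/\ bijective F,
      forall c : k, F c%:A = c%:A,
      F x = x * y * x^-1 &
      F y = (1 + y ^+ r) * x^-1].

End FreeSkewField.

(** x^{a_1} y^{b_1} ... x^{a_m} y^{b_m} for s = [:: (a_1, b_1); ...; (a_m, b_m)];
    the exponents are integers and the product is ordered. *)
Definition Laurent_monomial (K : unitRingType) (x y : K)
    (s : seq (int * int)) : K :=
  \prod_(p <- s) (x ^ p.1 * y ^ p.2).

Definition nonneg_Laurent_polynomial (K : unitRingType) (x y u : K) : Prop :=
  exists t : seq (nat * seq (int * int)),
    u = \sum_(q <- t) Laurent_monomial x y q.2 *+ q.1.

(* Main.v *)
Require Import Defs.
From HB Require Import structures.
From mathcomp Require Import all_boot all_order all_algebra.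
From Stdlib Require Import FunctionalExtensionality.

Import GRing.Theory.
Local Open Scope ring_scope.
Set Implicit Arguments.
Unset Strict Implicit.
Unset Printing Implicit Defensive.

Local Arguments GRing.exp : simpl never.

(** Let q = x y x^-1 y^-1.  It is fixed by F, and x y x^-1 = q y, so that
    F^(n+1)(x) = q F^n(y): only the iterates of y matter.

    Put H = F(y) = (1 + y^r) x^-1 and v = F(x)^-1 = x y^-1 x^-1.  Then
    F(H) = (1 + H^r) v and F(v) = v^-1 H^-1 v.  Both H and v are nonnegative
    Laurent polynomials; the difficulty is the factor H^-1.  Two facts remove
    it.  The relation H v = y^-1 H gives H v^a H^-1 = y^-a, so that an H further
    left absorbs H^-1 across a power of v; and 1 + v^-r = x H gives
    (v^r + 1) F(v) = v^(r-1) x v, so that with no H available two terms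
    can be added to make H^-1 disappear.

    For r > 1, F^(n+3)(y) is a sum over labellings of a word with letters L
    (long) and S (short).  A long block has r horizontal steps and a short one
    r - 1; each step is labelled v or H^r v, and the block ends with F(v), so
    a step contributes v + H^r v and the block is closed by H^-1.  If all its
    steps are labelled v there is a second labelling, where F(v) is preceded by
    v^-r.  The second labelling is always allowed in a long block, and allowed
    in a short block unless the part already read ends with H^s v, s > 0, after
    the cancellations above.  The sum is computed from left to right by a stack
    that records the powers of H still available ([transfer]).  It is a
    nonnegative Laurent polynomial by the two facts above ([nonneg_transfer]),
    and F sends the sum of a word to the sum of the word in which L is replaced
    by L^(r-1) S and S by L^(r-2) S ([transfer_refine]).  Since F^3(y) is the
    sum of the word L, all iterates are obtained.  The heart of the matter is
    the identity [refine_unskip_pop], which says that the second labelling of a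
    short block accounts exactly for what the substitution leaves unmatched.

    For r = 1 the substitution makes no sense, but F^5(y) = q y q^-1. *)

(** * Nonnegative Laurent polynomials *)

Section NonnegLaurent.
Variables (K : unitRingType) (x y : K).
Local Notation pos := (nonneg_Laurent_polynomial x y).

Lemma nonneg_Laurent0 : pos 0.
Proof. by exists [::]; rewrite big_nil. Qed.

Lemma nonneg_LaurentD a b : pos a -> pos b -> pos (a + b).
Proof. by move=> [s ->] [t ->]; exists (s ++ t); rewrite big_cat. Qed.

Lemma Laurent_monomial_cat s t :
  Laurent_monomial x y (s ++ t) =
  Laurent_monomial x y s * Laurent_monomial x y t.
Proof. by rewrite /Laurent_monomial big_cat. Qed.

Lemma nonneg_LaurentM a b : pos a -> pos b -> pos (a * b).
Proof.
move=> [s ->] [t ->].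
exists [seq ((p.1 * q.1)%N, p.2 ++ q.2) | p <- s, q <- t].
rewrite big_allpairs_dep mulr_suml; apply: eq_bigr => p _.
rewrite mulr_sumr; apply: eq_bigr => q _ /=.
by rewrite Laurent_monomial_cat mulrnAl mulrnAr -mulrnA mulnC.
Qed.

Lemma nonneg_Laurent_monomial i j : pos (x ^ i * y ^ j).
Proof.
by exists [:: (1%N, [:: (i, j)])]; rewrite big_seq1 /Laurent_monomial big_seq1.
Qed.

Lemma nonneg_Laurent1 : pos 1.
Proof. by have := nonneg_Laurent_monomial 0 0; rewrite !expr0z mulr1. Qed.

Lemma nonneg_Laurent_x : pos x.
Proof. by have := nonneg_Laurent_monomial 1 0; rewrite expr0z mulr1. Qed.

Lemma nonneg_Laurent_y : pos y.
Proof. by have := nonneg_Laurent_monomial 0 1; rewrite expr0z mul1r. Qed.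

Lemma nonneg_LaurentVx : pos x^-1.
Proof. by have := nonneg_Laurent_monomial (-1) 0; rewrite expr0z mulr1. Qed.

Lemma nonneg_LaurentVy : pos y^-1.
Proof. by have := nonneg_Laurent_monomial 0 (-1); rewrite expr0z mul1r. Qed.

Lemma nonneg_LaurentX a n : pos a -> pos (a ^+ n).
Proof.
move=> pos_a; elim: n => [|n IHn].
  by rewrite expr0; apply: nonneg_Laurent1.
by rewrite exprS; apply: nonneg_LaurentM.
Qed.

End NonnegLaurent.

(** * Reading a word of blocks with a stack *)

Lemma exprn_intertwine (K : pzRingType) (a b c : K) n :
  a * b = c * a -> a * b ^+ n = c ^+ n * a.
Proof.
move=> abE; elim: n => [|n IHn]; first by rewrite !expr0 mulr1 mul1r.
by rewrite exprSr mulrA IHn -mulrA abE mulrA -exprSr.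
Qed.

(** The part of a word already read, after cancellation.  An entry (s, a)
    stands for H^(s+1) v^(a+1), the head of the list being the rightmost
    factor; exponents are shifted because neither of them may vanish.  The
    empty stack means that no H is available for cancellation. *)
Definition stack := seq (nat * nat).

(** A functional f sends a stack p to the sum, over all labellings of the rest
    of the word, of the products of p with what follows.  Whatever stands to the
    left of an empty stack has been factored out, which is why the operators
    below may multiply f [::] on the left.  Each operator prepends one action of
    the reader to f. *)
Section Operators.
Variables (K : unitRingType) (r : nat) (H v : K).
Implicit Types (f g : stack -> K) (p : stack).

(** The image of v under the automorphism, closing a block. *)
Definition vertical := v^-1 * H^-1 * v.

Fixpoint stack_value p : K :=
  if p is (s, a) :: p' then stack_value p' * (H ^+ s.+1 * v ^+ a.+1) else 1.

(** Reading v and reading H^r v; [step] adds the two labels of a step. *)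
Definition skip f p : K :=
  if p is (s, a) :: p' then f ((s, a.+1) :: p') else v * f [::].

Definition push f p : K := f ((r.-1, 0%N) :: p).

Definition step f p : K := skip f p + push f p.

(** Reading v^-1 H^-1 v.  After H^(s+1) v it only cancels one H, leaving H^s v;
    for s = 0 the remaining v joins the entry below.  After H^(s+1) v^(a+2) it
    leaves H^s y^-(a+1) v, and no later H^-1 is moved across this power of y:
    the whole product is factored out and reading goes on with the empty
    stack. *)
Definition pop f p : K :=
  match p with
  | [::] => vertical * f [::]
  | (_, _.+1) :: _ => stack_value p * vertical * f [::]
  | (s.+1, 0%N) :: p' => f ((s, 0%N) :: p')
  | (0%N, 0%N) :: p' => skip f p'
  end.

(** Cancelling the last v.  The value 0 forbids the labelling that would leave
    a bare power of H on top of the stack. *)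
Definition unskip f p : K :=
  match p with
  | [::] => v^-1 * f [::]
  | (s, a.+1) :: p' => f ((s, a) :: p')
  | (_, 0%N) :: _ => 0
  end.

(** The second summands come from the labelling with all steps equal to v and
    an additional v^-r: the net contribution of the steps is v^r v^-r = 1 in a
    long block and v^(r-1) v^-r = v^-1 in a short one. *)
Definition long_block f p : K := iter r step (pop f) p + pop f p.

Definition short_block f p : K := iter r.-1 step (pop f) p + unskip (pop f) p.

Definition transfer (w : seq bool) : stack -> K :=
  foldr (fun b => if b then long_block else short_block) stack_value w.

(** The automorphism maps H to v + H^r v, which reads as one step, and v to
    v^-1 H^-1 v.  So the image of an entry H^(s+1) v^(a+1) is obtained by
    reading s+1 steps and then a+1 closing factors, starting from the image of
    the entries below. *)
Fixpoint refine g p : K :=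
  if p is (s, a) :: p' then refine (iter s.+1 step (iter a.+1 pop g)) p'
  else g [::].

End Operators.

Lemma verticalE (K : unitRingType) (H v : K) : vertical H v = v^-1 * H^-1 * v.
Proof. by []. Qed.

Section OperatorTheory.
Variables (K : unitRingType) (r : nat) (H v : K).
Implicit Types (f g : stack -> K) (p : stack).
Local Notation skip' := (skip v).
Local Notation push' := (push r).
Local Notation step' := (step r v).
Local Notation pop' := (pop H v).
Local Notation unskip' := (unskip v).

Lemma skipK g : v \is a GRing.unit -> skip' (unskip' g) = g.
Proof.
move=> v_unit; apply: functional_extensionality => -[|[s a] p] //=.
by rewrite mulVKr.
Qed.

Lemma step_unskip g : v \is a GRing.unit -> step' (unskip' g) = g.
Proof.
move=> v_unit; apply: functional_extensionality => p.
by rewrite /step skipK // /push /= addr0.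
Qed.

Lemma iter_step_unskip n g : v \is a GRing.unit ->
  iter n step' (iter n unskip' g) = g.
Proof.
by move=> v_unit; elim: n g => //= n IHn g; rewrite -iterS iterSr step_unskip.
Qed.

Lemma stepD f g p : step' (fun p => f p + g p) p = step' f p + step' g p.
Proof.
by rewrite /step /push; case: p => [|[s a] p] /=; rewrite ?mulrDr addrACA.
Qed.

Lemma popD f g p : pop' (fun p => f p + g p) p = pop' f p + pop' g p.
Proof.
case: p => [|[[|s] [|a]] p] //=; rewrite ?mulrDr //.
by case: p => [|[]] //=; rewrite mulrDr.
Qed.

Lemma iter_additive (op : (stack -> K) -> stack -> K) n f g :
    (forall f g p, op (fun p => f p + g p) p = op f p + op g p) ->
  iter n op (fun p => f p + g p) = fun p => iter n op f p + iter n op g p.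
Proof.
move=> opD; elim: n => //= n ->; exact: functional_extensionality.
Qed.

Lemma iter_unskip_nil n f : iter n unskip' f [::] = v ^- n * f [::].
Proof.
elim: n => [|n IHn]; first by rewrite expr0 invr1 mul1r.
by rewrite iterS /= IHn mulrA -exprVn -exprS exprVn.
Qed.

Lemma iter_unskip_cons n f s a p :
  iter n unskip' f ((s, a) :: p) =
  if (a < n)%N then 0 else f ((s, a - n)%N :: p).
Proof.
elim: n a => [|n IHn] a; first by rewrite subn0.
by case: a => [|a] //=; rewrite IHn.
Qed.

End OperatorTheory.

(** * The automorphism acts by substitution on words *)

(** In this section Y and w stand for the images of H and v, and the operators
    with parameters Y and w are those of the image alphabet.  They are expressed
    through the operators with parameters H and v by means of [refine]. *)
Section Refinement.
Variables (K : unitRingType) (r' : nat) (H v : K).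
Local Notation r := r'.+1.
Variables (Y : K).
Hypotheses (YE : Y = (1 + H ^+ r) * v).
Hypotheses (H_unit : H \is a GRing.unit) (v_unit : v \is a GRing.unit).
Implicit Types (f g : stack -> K) (p : stack).
Local Notation w := (vertical H v).
Local Notation val := (stack_value H v).
Local Notation skip' := (skip v).
Local Notation push' := (push r).
Local Notation step' := (step r v).
Local Notation pop' := (pop H v).
Local Notation unskip' := (unskip v).
Local Notation refine' := (refine r H v).

(** The functionals that see only the value of the stack.  On them the
    operators act by left multiplication in K. *)
Definition value_times (c : K) p := val p * c.

Lemma refineD f g p :
  refine' (fun p => f p + g p) p = refine' f p + refine' g p.
Proof.
elim: p f g => [//|[s a] p IHp] f g.
rewrite /= -!iterS (iter_additive _ _ _ (popD H v)).
by rewrite (iter_additive _ _ _ (stepD r v)) IHp.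
Qed.

Lemma skip_value_times c : skip' (value_times c) = value_times (v * c).
Proof.
apply: functional_extensionality => -[|[s a] p];
  rewrite /value_times /= ?mul1r //.
by rewrite [v ^+ a.+2]exprSr !mulrA.
Qed.

Lemma step_value_times c : step' (value_times c) = value_times (Y * c).
Proof.
apply: functional_extensionality => p.
rewrite /step skip_value_times /push /value_times /= expr1 YE.
by rewrite -!mulrA -mulrDr mulrDl mul1r.
Qed.

Lemma pop_value_times c : pop' (value_times c) = value_times (w * c).
Proof.
apply: functional_extensionality => -[|[[|s] [|a]] p]; rewrite /value_times /=.
- by rewrite !mul1r.
- by rewrite skip_value_times /value_times !expr1 verticalE -!mulrA !mulVKr.
- by rewrite mul1r [RHS]mulrA.
- rewrite !expr1 [H ^+ s.+2]exprSr verticalE.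
  by rewrite -!(mulrA (val p)) -!(mulrA (H ^+ s.+1)) -!mulrA !mulVKr.
- by rewrite mul1r [RHS]mulrA.
Qed.

Lemma iter_value_times (op : (stack -> K) -> stack -> K) (a c : K) n :
    (forall c, op (value_times c) = value_times (a * c)) ->
  iter n op (value_times c) = value_times (a ^+ n * c).
Proof.
move=> opE; elim: n => [|n IHn]; first by rewrite expr0 mul1r.
by rewrite iterS IHn opE mulrA -exprS.
Qed.

Lemma refine_value_times c p :
  refine' (value_times c) p = stack_value Y w p * c.
Proof.
elim: p c => [|[s a] p IHp] c; first by rewrite /= /value_times.
rewrite [LHS]/= -!iterS (iter_value_times _ _ pop_value_times).
by rewrite (iter_value_times _ _ step_value_times) IHp /= !mulrA.
Qed.

Lemma iter_pop_nil n f : iter n pop' f [::] = w ^+ n * f [::].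
Proof.
by elim: n => [|n IHn]; rewrite ?expr0 ?mul1r // iterS /= IHn mulrA -exprS.
Qed.

(** If v has just been read then the top entry, if any, is H^(s+1) v^(a+2), and
    the closing factor empties the stack in every case. *)
Lemma skip_pop f : skip' (pop' f) = value_times (v * w * f [::]).
Proof.
apply: functional_extensionality => -[|[s a] p]; rewrite /value_times /=.
  by rewrite mul1r mulrA.
by rewrite [v ^+ a.+2]exprSr; case: s => [|s]; rewrite !mulrA.
Qed.

Lemma iter_pop_low s n f p :
  (n <= s)%N -> iter n pop' f ((s, 0%N) :: p) = f ((s - n, 0%N)%N :: p).
Proof.
elim: n s f => [|n IHn] s f; first by rewrite subn0.
by case: s => // s le_ns; rewrite iterSr IHn 1?ltnW // subSn.
Qed.

Lemma push_iter_pop_low n f p :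
  (n <= r')%N -> push' (iter n pop' f) p = f ((r' - n, 0%N)%N :: p).
Proof. exact: iter_pop_low. Qed.

(** After H^r v, exactly r closing factors use up the r copies of H and
    leave v. *)
Lemma push_iter_pop_high n f :
  push' (iter (r + n) pop' f) = skip' (iter n pop' f).
Proof.
apply: functional_extensionality => p.
by rewrite addSnnS iterD push_iter_pop_low // subnn.
Qed.

Hypothesis Y_unit : Y \is a GRing.unit.
Local Notation w2 := (vertical Y w).
Local Notation pop2 := (pop Y w).
Local Notation val2 := (stack_value Y w).

Lemma vertical_unit : w \is a GRing.unit.
Proof. by rewrite verticalE !unitrMl ?unitrV. Qed.

Lemma vw_pow n : v * w ^+ n = H ^- n * v.
Proof.
rewrite -exprVn; apply: exprn_intertwine.
by rewrite verticalE !mulrA mulrV // mul1r.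
Qed.

Lemma Yw_pow n : Y * w ^+ n = H ^- n * Y.
Proof.
rewrite YE -mulrA vw_pow !mulrA; congr (_ * v).
apply: commrV; apply: commrX; apply: commr_sym; apply: commrD.
  exact: commr1.
exact: commrX.
Qed.

(** w is conjugate to H^-1 both by v and by Y, because Y v^-1 = 1 + H^r commutes
    with H. *)
Lemma vertical_next n : Y * (w ^+ n.+1 * w2) = v * w ^+ n * v^-1 * w.
Proof.
have w_unit := vertical_unit.
rewrite [w2]verticalE [w ^+ n.+1]exprSr.
rewrite -(mulrA w^-1) -(mulrA (w ^+ n)) mulVKr //.
by rewrite (mulrA Y) Yw_pow -(mulrA _ Y) mulVKr // vw_pow mulrK.
Qed.

(** As w^-1 = v^-1 H v, the sum 1 + w^-r is v^-1 (1 + H^r) v = v^-1 Y, and the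
    closing factor of the image alphabet is w^-1 Y^-1 w.  This is the case of
    the empty stack in [refine_unskip_pop]. *)
Lemma vertical_pair : v^-1 * w = (w + w ^- r') * w2.
Proof.
have wV : v * w ^- r = H ^+ r * v.
  apply: (@mulIr _ (w ^+ r)); first by rewrite unitrX ?vertical_unit.
  rewrite mulrVK ?unitrX ?vertical_unit // -mulrA vw_pow mulrA mulrV ?mul1r //.
  by rewrite unitrX.
rewrite [w2]verticalE [RHS]mulrA; congr (_ * w); rewrite [RHS]mulrA.
apply: (@mulIr _ Y) => //; rewrite mulrVK //.
rewrite [RHS]mulrDl mulrV ?vertical_unit //.
rewrite -invrM ?unitrX ?vertical_unit // -exprS.
apply: (@mulrI _ v) => //; rewrite mulVKr // mulrDr mulr1 wV.
by rewrite YE mulrDl mul1r.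
Qed.

(** Splits according to the label of the last of the s+1 steps.  If it is v,
    the first closing factor empties the stack, and the outcome no longer
    depends on what was read before. *)
Lemma refine_step_pop s n f p :
  refine' (iter s.+1 step' (iter n.+1 pop' f)) p =
  val2 p * (Y ^+ s * (v * w ^+ n.+1 * f [::])) +
  refine' (iter s step' (push' (iter n.+1 pop' f))) p.
Proof.
rewrite iterSr.
have -> : step' (iter n.+1 pop' f) =
    fun p => value_times (v * w ^+ n.+1 * f [::]) p +
             push' (iter n.+1 pop' f) p.
  apply: functional_extensionality => q; rewrite /step iterS skip_pop.
  by rewrite iter_pop_nil exprS !mulrA.
rewrite (iter_additive _ _ _ (stepD r v)) refineD.
by rewrite (iter_value_times _ _ step_value_times) refine_value_times.
Qed.

Lemma refine_skip g : skip w (refine' g) = refine' (pop' g).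
Proof.
apply: functional_extensionality => -[|[s a] p] //.
by rewrite /= -!iterS -iterSr.
Qed.

(** The last step is H^r v, followed by a+1 closing factors.  If a+1 < r the
    stack ends with a positive power of H and a single v, and [unskip] gives 0;
    on the right the removal of r-1 factors w gives 0 as well.  If a+1 >= r,
    all of H^r is used up and a+1-r closing factors remain; the sides agree by
    [vertical_next] or, when none remains, by [skipK]. *)
Lemma refine_step_push s a g p :
  refine' (iter s step' (push' (iter a.+1 pop' (unskip' (pop' g))))) p =
  iter r' (unskip w) (pop2 (refine' g)) ((s, a) :: p).
Proof.
rewrite iter_unskip_cons; case: ltnP => [lt_ar|le_ra].
  have -> : push' (iter a.+1 pop' (unskip' (pop' g))) = value_times 0.
    apply: functional_extensionality => q.
    by rewrite push_iter_pop_low // /value_times mulr0.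
  by rewrite (iter_value_times _ _ step_value_times) refine_value_times !mulr0.
have -> : a.+1 = (r + (a - r'))%N by rewrite addSn subnKC.
rewrite push_iter_pop_high; case: (a - r')%N => [|n] /=.
  rewrite skipK //; case: s => [|s] //.
  by rewrite refine_skip.
rewrite skip_pop (iter_value_times _ _ step_value_times).
rewrite refine_value_times iter_pop_nil /=.
have -> : stack_value Y w p * (Y ^+ s.+1 * w ^+ n.+2) * w2 * g [::] =
  stack_value Y w p * (Y ^+ s * (Y * (w ^+ n.+2 * w2)) * g [::]).
  by rewrite exprSr !mulrA.
by case: s => [|s]; rewrite vertical_next [w ^+ n.+1]exprS !mulrA.
Qed.

(** The second labelling of a short block, seen from the image alphabet, is one
    step labelled w with its closing factor, plus what closes the block once
    r-1 steps labelled w have been undone.  When at most r-1 steps have been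
    read since the last closing factor, the latter term vanishes as soon as one
    of them is labelled Y^r w.  The two terms match the two labels of the last
    step of the top entry, by [refine_step_pop] and [refine_step_push]. *)
Lemma refine_unskip_pop g p :
  refine' (unskip' (pop' g)) p =
  skip w (pop2 (refine' g)) p + iter r' (unskip w) (pop2 (refine' g)) p.
Proof.
case: p => [|[s a] p].
  rewrite iter_unskip_nil /= (mulrA v^-1) vertical_pair.
  by rewrite -(mulrA (w + _)) mulrDl.
rewrite -refine_step_push [LHS]/= -!iterS refine_step_pop; congr (_ + _).
have -> : skip w (pop2 (refine' g)) ((s, a) :: p) =
  stack_value Y w p * (Y ^+ s * (Y * (w ^+ a.+2 * w2)) * g [::]).
  by case: s => [|s] /=; rewrite [Y ^+ _.+1]exprSr !mulrA.
by rewrite vertical_next /= !mulrA.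
Qed.

Lemma refine_step g : step r w (refine' g) = refine' (long_block r H v g).
Proof.
apply: functional_extensionality => p.
by rewrite /step refine_skip /long_block refineD addrC.
Qed.

Lemma pop_refine n g p :
  pop2 (refine' g) ((n, 0%N) :: p) = refine' (iter n step' (pop' g)) p.
Proof. by case: n => [|n] //=; rewrite refine_skip. Qed.

Lemma refine_short_block g :
  refine' (short_block r H v g) =
  fun p => step r w (pop2 (refine' g)) p +
           iter r' (unskip w) (pop2 (refine' g)) p.
Proof.
apply: functional_extensionality => p.
rewrite /short_block refineD refine_unskip_pop addrA; congr (_ + _).
rewrite /step addrC; congr (_ + _).
by rewrite /push pop_refine.
Qed.

Lemma iter_refine_step n g :
  iter n (step r w) (refine' g) = refine' (iter n (long_block r H v) g).
Proof. by elim: n g => // n IHn g; rewrite !iterSr refine_step IHn. Qed.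

(** Reading n steps undoes n cancellations, so with n = r-1 the last summand is
    the second labelling of a long block, and with n = r-2 that of a short
    one. *)
Lemma iter_step_refine_short n g : (n <= r')%N ->
  iter n (step r w) (refine' (short_block r H v g)) =
  fun p => iter n.+1 (step r w) (pop2 (refine' g)) p +
           iter (r' - n) (unskip w) (pop2 (refine' g)) p.
Proof.
move=> le_nr; rewrite refine_short_block (iter_additive _ _ _ (stepD r w)).
apply: functional_extensionality => p; rewrite iterSr; congr (_ + _).
rewrite -[X in iter X (unskip w)](subnKC le_nr) iterD.
by rewrite iter_step_unskip ?vertical_unit.
Qed.

Lemma long_block_refine g :
  long_block r Y w (refine' g) =
  refine' (iter r' (long_block r H v) (short_block r H v g)).
Proof. by rewrite -iter_refine_step iter_step_refine_short // subnn. Qed.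

Lemma short_block_refine g : (0 < r')%N ->
  short_block r Y w (refine' g) =
  refine' (iter r'.-1 (long_block r H v) (short_block r H v g)).
Proof.
move=> r'_gt0; rewrite -iter_refine_step iter_step_refine_short ?leq_pred //.
by rewrite prednK // -subn1 subKn.
Qed.

(** The substitution, with true for long and false for short blocks. *)
Definition refine_block (b : bool) : seq bool :=
  rcons (nseq (if b then r' else r'.-1) true) false.

Lemma transfer_refine (u : seq bool) : (0 < r')%N ->
  transfer r Y w u = refine' (transfer r H v (flatten (map refine_block u))).
Proof.
move=> r'_gt0; elim: u => [|b u IHu] /=.
  apply: functional_extensionality => p.
  have -> : stack_value H v = value_times 1.
    by apply: functional_extensionality => q; rewrite /value_times mulr1.
  by rewrite refine_value_times mulr1.
have long_blocks n f :
    foldr (fun b => if b then long_block r H v else short_block r H v) f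
      (nseq n true) = iter n (long_block r H v) f.
  by elim: n => //= n ->.
rewrite IHu /transfer foldr_cat foldr_rcons long_blocks.
by case: b; rewrite ?long_block_refine ?short_block_refine.
Qed.

End Refinement.

(** * Positivity of the transfer functionals *)

Section Positivity.
Variables (K : unitRingType) (x y : K) (r' : nat).
Local Notation r := r'.+1.
Local Notation pos := (nonneg_Laurent_polynomial x y).
Variables (H v : K).
Hypotheses (HE : H = (1 + y ^+ r) * x^-1) (vE : v = x * y^-1 * x^-1).
Hypotheses (x_unit : x \is a GRing.unit) (y_unit : y \is a GRing.unit).
Hypothesis H_unit : H \is a GRing.unit.
Local Notation w := (vertical H v).
Implicit Types (f : stack -> K) (p : stack).

Local Hint Resolve nonneg_Laurent0 nonneg_Laurent1 nonneg_Laurent_x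
  nonneg_Laurent_y nonneg_LaurentVx nonneg_LaurentVy nonneg_LaurentD
  nonneg_LaurentM nonneg_LaurentX : nonneg.

Lemma v_inverse : v^-1 = x * y * x^-1.
Proof. by rewrite vE !invrM ?invrK ?unitrMl ?unitrV // mulrA. Qed.

Lemma v_is_unit : v \is a GRing.unit.
Proof. by rewrite vE !unitrMl ?unitrV. Qed.

Lemma nonneg_v : pos v.
Proof. by rewrite vE; auto with nonneg. Qed.

Lemma nonneg_Vv : pos v^-1.
Proof. by rewrite v_inverse; auto with nonneg. Qed.

Lemma nonneg_H : pos H.
Proof. by rewrite HE; auto with nonneg. Qed.

Lemma Hv_pow n : H * v ^+ n = y ^- n * H.
Proof.
rewrite -exprVn; apply: exprn_intertwine.
rewrite HE vE -!mulrA mulKr // !mulrA; congr (_ / _).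
apply: commrV; apply: commr_sym; apply: commrD; first exact: commr1.
exact: commrX.
Qed.

Lemma one_plus_Vv : 1 + v ^- r = x * H.
Proof.
rewrite -exprVn v_inverse.
have -> n : (x * y / x) ^+ n = x * y ^+ n / x.
  elim: n => [|n IHn]; first by rewrite !expr0 mulr1 mulrV.
  by rewrite !exprSr IHn !mulrA mulrVK.
by rewrite HE mulrA mulrDr mulr1 mulrDl mulrV.
Qed.

(** With no H available, the two labellings of a block whose steps are all v are
    Laurent only when added. *)
Lemma vertical_free : (v ^+ r + 1) * w = v ^+ r' * x * v.
Proof.
have v_unit := v_is_unit.
have vrE : v ^+ r + 1 = v ^+ r' * (x * H) * v.
  rewrite -one_plus_Vv mulrDr mulr1 mulrDl -exprSr; congr (_ + _).
  by rewrite exprS invrM ?unitrX // mulrA mulrV ?unitrX // mul1r mulVr.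
rewrite vrE verticalE -!mulrA mulVKr //; congr (_ * (_ * _)).
by rewrite !mulrA mulrV ?mul1r.
Qed.

(** Closing a block is harmless as long as the stack is nonempty; on the empty
    stack [pop] produces an H^-1, and the values there are only controlled for
    whole blocks. *)
Definition nonneg_above f := forall s a p, pos (f ((s, a) :: p)).

Lemma nonneg_stack_value p : pos (stack_value H v p).
Proof.
by elim: p => [|[s a] p IHp] /=; auto 6 using nonneg_H, nonneg_v with nonneg.
Qed.

Lemma nonneg_above_step f : nonneg_above f -> nonneg_above (step r v f).
Proof. by move=> pos_f s a p; apply: nonneg_LaurentD; apply: pos_f. Qed.

Lemma nonneg_above_iter_step n f :
  nonneg_above f -> nonneg_above (iter n (step r v) f).
Proof. by move=> pos_f; elim: n => // n; apply: nonneg_above_step. Qed.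

(** A labelling with at least one H^r v makes the stack nonempty, which leaves
    only the labelling by v to be examined. *)
Lemma nonneg_step_nil f n : nonneg_above f ->
  exists2 c, pos c & iter n (step r v) f [::] = v ^+ n * f [::] + c.
Proof.
move=> pos_f; elim: n => [|n [c pos_c stepE]].
  by exists 0; [exact: nonneg_Laurent0 | rewrite expr0 mul1r addr0].
exists (v * c + iter n (step r v) f [:: (r', 0%N)]).
  apply: nonneg_LaurentD; last exact: nonneg_above_iter_step.
  by auto using nonneg_v with nonneg.
by rewrite iterS /step /= stepE mulrDr addrA mulrA -exprS.
Qed.

Lemma nonneg_above_pop f : (forall p, pos (f p)) -> nonneg_above (pop H v f).
Proof.
move=> pos_f s a p; case: a => [|a].
  case: s => [|s] //=; case: p => [|[s a] p] //=.
  by auto using nonneg_v with nonneg.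
have -> : pop H v f ((s, a.+1) :: p) =
    stack_value H v p * (H ^+ s * (y ^- a.+1 * v)) * f [::].
  have -> : y ^- a.+1 = H * v ^+ a.+1 / H by rewrite Hv_pow mulrK.
  rewrite /pop verticalE /= [H ^+ s.+1]exprSr [v ^+ a.+2]exprSr.
  case: s => [|s]; rewrite -!mulrA mulVKr ?v_is_unit //.
have := nonneg_stack_value p; rewrite -exprVn.
by auto 8 using nonneg_v, nonneg_H with nonneg.
Qed.

Lemma nonneg_long_block f :
  (forall p, pos (f p)) -> forall p, pos (long_block r H v f p).
Proof.
move=> pos_f; have pos_pop := nonneg_above_pop pos_f.
case=> [|[s a] p]; rewrite /long_block; last first.
  by apply: nonneg_LaurentD => //; apply: nonneg_above_iter_step.
have [c pos_c ->] := nonneg_step_nil r pos_pop.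
rewrite addrAC /= mulrA -mulrDl.
have -> : v ^+ r * w + w = v ^+ r' * x * v.
  by rewrite -vertical_free mulrDl mul1r.
by auto 8 using nonneg_v with nonneg.
Qed.

Lemma nonneg_short_block f :
  (forall p, pos (f p)) -> forall p, pos (short_block r H v f p).
Proof.
move=> pos_f; have pos_pop := nonneg_above_pop pos_f.
case=> [|[s a] p]; rewrite /short_block; last first.
  apply: nonneg_LaurentD; first exact: nonneg_above_iter_step.
  by case: a => [|a]; [exact: nonneg_Laurent0 | exact: pos_pop].
have [c pos_c ->] := nonneg_step_nil r.-1 pos_pop.
have pairE : v ^+ r' * w + v^-1 * w = v^-1 * (v ^+ r' * x * v).
  rewrite -vertical_free [v ^+ r]exprS mulrA mulrDr mulr1 mulKr ?v_is_unit //.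
  by rewrite mulrDl.
rewrite addrAC /= (mulrA (v ^+ r')) (mulrA v^-1) -mulrDl pairE.
by auto 8 using nonneg_v, nonneg_Vv with nonneg.
Qed.

Lemma nonneg_transfer u p : pos (transfer r H v u p).
Proof.
elim: u p => [|b u IHu]; first exact: nonneg_stack_value.
by case: b; [apply: nonneg_long_block | apply: nonneg_short_block].
Qed.

End Positivity.

(** * Iterates of the automorphism *)

Section Functoriality.
Variables (K : unitRingType) (F : {rmorphism K -> K}) (r : nat) (H v : K).
Hypotheses (H_unit : H \is a GRing.unit) (v_unit : v \is a GRing.unit).
Implicit Types (f : stack -> K) (p : stack).

Lemma rmorph_vertical : F (vertical H v) = vertical (F H) (F v).
Proof. by rewrite !rmorphM !rmorphV. Qed.

Lemma rmorph_stack_value p : F (stack_value H v p) = stack_value (F H) (F v) p.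
Proof.
elim: p => [|[s a] p IHp] /=; first exact: rmorph1.
by rewrite !rmorphM !rmorphXn IHp.
Qed.

Lemma rmorph_skip f : F \o skip v f = skip (F v) (F \o f).
Proof.
by apply: functional_extensionality => -[|[s a] p] //=; rewrite rmorphM.
Qed.

Lemma rmorph_step f : F \o step r v f = step r (F v) (F \o f).
Proof.
apply: functional_extensionality => p.
by rewrite /step -rmorph_skip /= rmorphD.
Qed.

Lemma rmorph_iter_step n f :
  F \o iter n (step r v) f = iter n (step r (F v)) (F \o f).
Proof. by elim: n => //= n <-; rewrite rmorph_step. Qed.

Lemma rmorph_pop f : F \o pop H v f = pop (F H) (F v) (F \o f).
Proof.
have popE s a p : F (stack_value H v ((s, a) :: p) * vertical H v * f [::]) =
    stack_value (F H) (F v) ((s, a) :: p) * vertical (F H) (F v) * F (f [::]).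
  by rewrite 2!rmorphM rmorph_vertical rmorph_stack_value.
apply: functional_extensionality => -[|[[|s] [|a]] p].
- by rewrite [LHS]rmorphM rmorph_vertical.
- by rewrite [RHS]/= -rmorph_skip.
- exact: popE.
- by [].
- exact: popE.
Qed.

Lemma rmorph_unskip f : F \o unskip v f = unskip (F v) (F \o f).
Proof.
apply: functional_extensionality => -[|[s [|a]] p] //=; last exact: rmorph0.
by rewrite rmorphM rmorphV.
Qed.

Lemma rmorph_transfer u :
  F \o transfer r H v u = transfer r (F H) (F v) u.
Proof.
elim: u => [|b u IHu] /=.
  by apply: functional_extensionality => p; rewrite /= rmorph_stack_value.
apply: functional_extensionality => p; rewrite -IHu; case: b.
  rewrite /long_block -rmorph_pop -rmorph_iter_step.
  by rewrite [LHS]/= rmorphD.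
rewrite /short_block -rmorph_pop -rmorph_iter_step -rmorph_unskip.
by rewrite [LHS]/= rmorphD.
Qed.
End Functoriality.

Section Iterates.
Variables (K : unitRingType) (x y : K) (r' : nat) (F : {rmorphism K -> K}).
Local Notation r := r'.+1.
Local Notation pos := (nonneg_Laurent_polynomial x y).
Variables (H v : K).
Hypotheses (HE : H = (1 + y ^+ r) * x^-1) (vE : v = x * y^-1 * x^-1).
Local Notation q := (x * y * x^-1 * y^-1).
Local Notation w := (vertical H v).
Hypotheses (x_unit : x \is a GRing.unit) (y_unit : y \is a GRing.unit).
Hypothesis num_unit : 1 + y ^+ r \is a GRing.unit.
Hypotheses (Fx : F x = x * y * x^-1) (Fy : F y = (1 + y ^+ r) * x^-1).

Lemma H_is_unit : H \is a GRing.unit.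
Proof. by rewrite HE unitrMl ?unitrV. Qed.

Let v_unit : v \is a GRing.unit := v_is_unit vE x_unit y_unit.

Lemma Fx_v : F x = v^-1.
Proof. by rewrite (v_inverse vE). Qed.

Lemma rmorph_v : F v = w.
Proof.
by rewrite vE !rmorphM !rmorphV // Fx_v Fy -HE -vE invrK verticalE.
Qed.

Lemma rmorph_H : F H = (1 + H ^+ r) * v.
Proof.
by rewrite HE rmorphM rmorphV // rmorphD rmorph1 rmorphXn Fx_v Fy -HE invrK.
Qed.

Lemma FH_unit : F H \is a GRing.unit.
Proof. exact/rmorph_unit/H_is_unit. Qed.

Lemma transfer_initial : transfer r H v [:: true] [::] = F (F (F y)).
Proof.
rewrite Fy -HE rmorph_H rmorphM rmorphD rmorph1 rmorphXn rmorph_v rmorph_H.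
have val1 : stack_value H v = value_times H v 1.
  by apply: functional_extensionality => q; rewrite /value_times mulr1.
rewrite /= /long_block val1 (pop_value_times H_is_unit) // mulr1.
rewrite (iter_value_times _ _ (step_value_times (erefl _))).
by rewrite /value_times /= [RHS]mulrDl !mul1r [RHS]addrC.
Qed.

Lemma iter_Fy_transfer n : (0 < r')%N ->
  iter n.+3 F y =
  transfer r H v
    (iter n (fun u => flatten (map (refine_block r') u)) [:: true]) [::].
Proof.
move=> r'_gt0; elim: n => [|n IHn]; first by rewrite transfer_initial.
rewrite iterS IHn -[LHS]/((F \o transfer r H v _) [::]).
rewrite rmorph_transfer ?H_is_unit // rmorph_v.
by rewrite (transfer_refine rmorph_H) ?H_is_unit ?FH_unit.
Qed.

Lemma nonneg_q : pos q.
Proof.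
by do 3 ?apply: nonneg_LaurentM; auto using nonneg_Laurent_x, nonneg_Laurent_y,
  nonneg_LaurentVx, nonneg_LaurentVy.
Qed.

Lemma q_unit : q \is a GRing.unit.
Proof. by rewrite !unitrMl ?unitrV. Qed.

Lemma Hv_twist : H * v = y^-1 * H.
Proof. by have := Hv_pow HE vE x_unit 1; rewrite !expr1. Qed.

Lemma rmorph_q : F q = q.
Proof.
rewrite !rmorphM !rmorphV // Fx_v Fy -HE invrK.
rewrite -(mulrA v^-1) Hv_twist mulrA mulrK ?H_is_unit //.
by rewrite (v_inverse vE).
Qed.

Lemma iter_qM n a : iter n F (q * a) = q * iter n F a.
Proof. by elim: n => //= n ->; rewrite rmorphM rmorph_q. Qed.

Lemma iter_Fx n : iter n.+1 F x = q * iter n F y.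
Proof. by rewrite iterSr Fx -iter_qM mulrVK. Qed.

Lemma nonneg_iter_Fy_small n : (n <= 3)%N -> pos (iter n F y).
Proof.
have pos_H := nonneg_H HE.
have pos_v := nonneg_v vE.
case: n => [|[|[|[|//]]]] _.
- exact: nonneg_Laurent_y.
- by rewrite /= Fy -HE.
- rewrite /= Fy -HE rmorph_H; apply: nonneg_LaurentM => //.
  by apply: nonneg_LaurentD; [exact: nonneg_Laurent1 | exact: nonneg_LaurentX].
- rewrite /= -transfer_initial.
  apply: (nonneg_transfer HE vE) => //; exact: H_is_unit.
Qed.

Lemma vertical_free1 : r' = 0%N -> (1 + v) * w = x * v.
Proof.
move=> r'0; have := vertical_free HE vE x_unit y_unit H_is_unit.
by rewrite r'0 expr1 expr0 mul1r addrC.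
Qed.

Lemma iter_Fy4 : r' = 0%N -> iter 4 F y = v^-1 * (x * v).
Proof.
move=> r'0; have H_unit := H_is_unit.
have vw : v * w = H^-1 * v.
  by have := vw_pow H v_unit 1; rewrite !expr1.
have F3 : F (F (F y)) = x * v + v.
  rewrite Fy -HE rmorph_H r'0 expr1 rmorphM rmorphD rmorph1 rmorph_v.
  rewrite rmorph_H r'0 expr1 [(1 + H) * v]mulrDl mul1r addrA [LHS]mulrDl.
  by rewrite vertical_free1 // -(mulrA H) vw mulVKr.
rewrite /= F3 rmorphD rmorphM rmorph_v Fx_v -vertical_free1 //.
by rewrite mulrDl mul1r mulrDr mulKr.
Qed.

(** For r = 1 the recursion y_{n+1} q y_{n-1} = 1 + y_n is the pentagon
    recurrence, whose solutions have period five when q is central; here the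
    period is only up to conjugation by q. *)
Lemma iter_Fy_period5 n :
  r' = 0%N -> iter (n + 5) F y = q * iter n F y * q^-1.
Proof.
move=> r'0; have H_unit := H_is_unit.
have Vv : v^-1 = q * y by rewrite (v_inverse vE) // mulrVK.
have F5 : iter 5 F y = q * y * q^-1.
  have HVv : H * v^-1 = y * H.
    by apply: (mulIr v_unit); rewrite mulrVK // -mulrA Hv_twist mulVKr.
  have wV : w^-1 = v^-1 * H * v.
    by rewrite verticalE !invrM ?invrK ?unitrMl ?unitrV // mulrA.
  rewrite iterS iter_Fy4 // rmorphM rmorphV // rmorphM rmorph_v Fx_v wV.
  rewrite {1}verticalE !mulrA mulrK // -(mulrA v^-1 H) HVv mulrA mulrK // Vv.
  have -> : v = y^-1 * q^-1 by rewrite -invrM ?q_unit // -Vv invrK.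
  by rewrite mulrA mulrK.
rewrite iterD F5.
by elim: n => //= n ->; rewrite 2!rmorphM rmorphV ?q_unit // rmorph_q.
Qed.

Lemma nonneg_iter_Fy n : pos (iter n F y).
Proof.
have H_unit := H_is_unit.
case: (posnP r') => [r'0|r'_gt0]; last first.
  case: (leqP n 3) => [|n_gt3]; first exact: nonneg_iter_Fy_small.
  rewrite -(subnK (ltnW n_gt3)) addn3 iter_Fy_transfer //.
  exact: (nonneg_transfer HE vE).
have pos_Vq : pos q^-1.
  rewrite !invrM ?invrK ?unitrMl ?unitrV //.
  by do 3 ?apply: nonneg_LaurentM; auto using nonneg_Laurent_x,
    nonneg_Laurent_y, nonneg_LaurentVx, nonneg_LaurentVy.
have pos_v := nonneg_v vE.
elim/ltn_ind: n => n IHn; case: (leqP n 3) => [|n_gt3].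
  exact: nonneg_iter_Fy_small.
have [->|n_neq4] := eqVneq n 4.
  rewrite iter_Fy4 //; apply: nonneg_LaurentM; first exact: (nonneg_Vv vE).
  by apply: nonneg_LaurentM => //; apply: nonneg_Laurent_x.
have n_gt4 : (4 < n)%N by rewrite ltn_neqAle eq_sym n_neq4.
rewrite -(subnK n_gt4) iter_Fy_period5 //.
apply: nonneg_LaurentM => //; apply: nonneg_LaurentM; first exact: nonneg_q.
by apply: IHn; rewrite ltn_subrL (leq_ltn_trans _ n_gt4).
Qed.

Lemma nonneg_iter_Fx n : pos (iter n F x).
Proof.
case: n => [|n]; first exact: nonneg_Laurent_x.
rewrite iter_Fx; apply: nonneg_LaurentM; first exact: nonneg_q.
exact: nonneg_iter_Fy.
Qed.

End Iterates.

(** * Units of the free skew field *)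

(** Specializing x to 1 and y to b inside K itself sends 1 + y^r to 1 + b^r;
    with b = 1 and b = 0 this shows that x, y and 1 + y^r are nonzero. *)
Lemma free_skew_field_units (k : fieldType) (K : unitAlgType k) (x y : K)
    (r : nat) : free_skew_field x y -> (0 < r)%N ->
  [/\ x \is a GRing.unit, y \is a GRing.unit & 1 + y ^+ r \is a GRing.unit].
Proof.
move=> [K_field _ K_univ] r_gt0.
have nonzero (b : K) : [/\ x != 0, b != 0 -> y != 0 &
    1 + b ^+ r != 0 -> 1 + y ^+ r != 0].
  have [S [phi]] := K_univ K 1 b K_field.
  case=> [[[S1 S_lin S_mul] Sx Sy] [phi_k phiD phiM] [phix phiy] _].
  have S0 : 0 \in S by have := S_lin (-1) 1 1 S1 S1; rewrite scaleN1r addNr.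
  have phi0 : phi 0 = 0.
    by apply: (addrI (phi 0)); rewrite -phiD // !addr0.
  have phi1 : phi 1 = 1 by rewrite -[X in phi X]scale1r phi_k scale1r.
  have nz u : phi u != 0 -> u != 0 by apply: contra_neq => ->.
  have [SX phiX] : y ^+ r \in S /\ phi (y ^+ r) = b ^+ r.
    elim: {r_gt0}r => [|n [SX phiX]]; first by rewrite !expr0.
    by rewrite !exprS; split; [apply: S_mul | rewrite phiM // phiX phiy].
  split; first by apply: nz; rewrite phix oner_eq0.
    by move=> b_neq0; apply: nz; rewrite phiy.
  by move=> b_neq0; apply: nz; rewrite phiD // phi1 phiX.
have [x_neq0 y_neq0 _] := nonzero 1; have [_ _ num_neq0] := nonzero 0.
split; apply: K_field => //; first by apply: y_neq0; rewrite oner_eq0.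
by apply: num_neq0; rewrite expr0n eqn0Ngt r_gt0 addr0 oner_eq0.
Qed.

Unset Implicit Arguments.

Theorem theorem1p2 (k : fieldType) (k_char0 : [pchar k] =i pred0)
    (K : unitAlgType k) (x y : K) (K_free : free_skew_field x y)
    (r : nat) (r_gt0 : (0 < r)%N)
    (F : {rmorphism K -> K}) (F_r : Kontsevich_automorphism x y r F)
    (m : nat) :
  nonneg_Laurent_polynomial x y (iter m (F \o F) x) /\
  nonneg_Laurent_polynomial x y (iter m (F \o F) y).
Proof.
have [x_unit y_unit num_unit] := free_skew_field_units K_free r_gt0.
have [_ _ Fx Fy] := F_r; case: r r_gt0 F_r num_unit Fy => // r' _ _ num_unit Fy.
have iter_square z : iter m (F \o F) z = iter (m + m) F z.
  by elim: m => //= n ->; rewrite addnS.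
by rewrite !iter_square; split;
  [apply: nonneg_iter_Fx | apply: nonneg_iter_Fy]; eassumption || exact: erefl.
Qed.
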